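(* Let $(P,\preceq,\vee)$ be a locally finite join semilattice, $S=\{x_1,x_2,\ldots,x_n\}$ a finite subset of $P$ ordered such that $x_i\preceq x_j$ only if $i\leq j$, and $f$ a complex-valued function on $P$. Let $d\geq 1$ be an integer and let $S^{\vee d}=\{y_1,y_2,\ldots,y_r\}$, $r=\# S^{\vee d}$, be ordered such that $y_i\preceq y_j$ only if $i\leq j$. Then the order $d$ join tensor $[S_d]_f$ has a $\# S^{\vee d}$-term polyadic decomposition given by \[ ([S_d]_f)_{i_1,i_2,\ldots,i_d}=\sum_{k=1}^r c_k E_{i_1,k}E_{i_2,k}\cdots E_{i_d,k},\qquad i_1,\ldots,i_d\in\{1,\ldots,n\}, \] where \[ c_k=\sum_{s:\,y_k\preceq y_s}f(y_s)\,\mu_{S^{\vee d}}(y_k,y_s),\qquad k\in\{1,2,\ldots,r\}, \] and $E$ is the $n\times r$ matrix defined by $E_{i,j}=1$ if $x_i\preceq y_j$ and $E_{i,j}=0$ otherwise, for $i\in\{1,\ldots,n\}$ and $j\in\{1,\ldots,r\}$.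
   Context: A poset $(P,\preceq)$ is locally finite if $\{z\in P\mid x\preceq z\preceq y\}$ is finite for all $x,y\in P$. A join semilattice is a nonempty poset in which any two elements $x,y$ have a least upper bound $x\vee y$. For $S=\{x_1,\ldots,x_n\}\subset P$ and an integer $k\ge 1$, $S^{\vee k}=\{x_{i_1}\vee x_{i_2}\vee\cdots\vee x_{i_k}\mid 1\leq i_1\leq i_2\leq\cdots\leq i_k\leq n\}$, and $\#$ denotes cardinality. The order $d$ join tensor on $S$ with respect to $f$ is the $n$-dimensional order $d$ tensor (array of $n^d$ entries) with $([S_d]_f)_{i_1,\ldots,i_d}=f(x_{i_1}\vee\cdots\vee x_{i_d})$, $i_1,\ldots,i_d\in\{1,\ldots,n\}$. $\mu_{S^{\vee d}}$ denotes the Möbius function of the finite poset $(S^{\vee d},\preceq)$: $\mu(x,x)=1$, $\mu(x,y)=-\sum_{x\preceq z\prec y}\mu(x,z)$ if $x\prec y$ (sum over $z\in S^{\vee d}$), and $\mu(x,y)=0$ otherwise. *)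

(* Defs.v *)
From HB Require Import structures.
From mathcomp Require Import all_boot all_order all_algebra.
From mathcomp Require Import finmap.
From mathcomp Require Import boolp classical_sets cardinality reals.
From mathcomp Require Import complex.

Set Implicit Arguments.
Unset Strict Implicit.
Unset Printing Implicit Defensive.

Import Order.TTheory GRing.Theory Num.Theory.

Local Open Scope ring_scope.

Definition locally_finite {disp : Order.disp_t} (P : porderType disp) : Prop :=
  forall a b : P, finite_set [set z : P | (a <= z <= b)%O].

(* The iterated join s_1 \/ ... \/ s_k. A join semilattice has no empty join:
   [p0] is a default value, only returned when [s] is empty. *)
Definition joins {disp : Order.disp_t} {P : joinSemilatticeType disp}
    (p0 : P) (s : seq P) : P :=
  if s is a :: s' then foldl Order.join a s' else p0.

(* S^{\/k} for S = {x_1, ..., x_n}; the value does not depend on [p0] when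
   0 < k. *)
Definition join_power {disp : Order.disp_t} {P : joinSemilatticeType disp}
    (p0 : P) {n : nat} (x : 'I_n -> P) (k : nat) : {fset P} :=
  [fset joins p0 [seq x j | j <- tval i]
     | i : k.-tuple 'I_n & sorted leq [seq val j | j <- i]]%fset.

(* The order d tensor ([S_d]_f), as a family indexed by (i_1, ..., i_d). *)
Definition join_tensor {disp : Order.disp_t} {P : joinSemilatticeType disp}
    {C : Type} (p0 : P) {n : nat} (x : 'I_n -> P) (f : P -> C) (d : nat)
    (i : d.-tuple 'I_n) : C :=
  f (joins p0 [seq x j | j <- i]).

(* The recursion on mu_A(a, _) is along chains of A, so that [#|` A|.+1] steps
   are enough: see [mobiusE]. *)
Fixpoint mobius_rec {disp : Order.disp_t} {P : porderType disp}
    (A : {fset P}) (m : nat) (a b : P) : int :=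
  if m is m'.+1 then
    if a == b then 1
    else if (a < b)%O then
      - \sum_(z <- A | (a <= z < b)%O) mobius_rec A m' a z
    else 0
  else 0.

Definition mobius {disp : Order.disp_t} {P : porderType disp}
    (A : {fset P}) (a b : P) : int :=
  mobius_rec A #|` A|.+1 a b.

Lemma mobius_rec_stable {disp : Order.disp_t} {P : porderType disp}
    (A : {fset P}) (a : P) (m1 m2 : nat) (b : P) :
  (count (fun z => (z < b)%O) A < m1)%N ->
  (count (fun z => (z < b)%O) A < m2)%N ->
  mobius_rec A m1 a b = mobius_rec A m2 a b.
Proof.
elim: m1 m2 b => [|m1 IH] [|m2] b //= h1 h2.
case: eqP => // _; case: ifP => // _; congr (- _).
rewrite big_seq_cond [RHS]big_seq_cond; apply: eq_bigr => z.
case/andP=> zA /andP[_ zb].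
suff lt_zb : (count (fun t => (t < z)%O) A < count (fun t => (t < b)%O) A)%N.
  by apply: IH; apply: leq_trans lt_zb _.
rewrite -!size_filter; set s := filter _ _; set t := filter _ _.
have us : uniq (z :: s).
  by rewrite /= mem_filter ltxx /= filter_uniq // fset_uniq.
apply: (@uniq_leq_size _ (z :: s)) => // u; rewrite inE => /predU1P[->|].
  by rewrite mem_filter zb.
by rewrite !mem_filter => /andP[uz ->]; rewrite (lt_trans uz zb).
Qed.

Lemma mobiusE {disp : Order.disp_t} {P : porderType disp}
    (A : {fset P}) (a b : P) :
  mobius A a b =
    if a == b then 1
    else if (a < b)%O then - \sum_(z <- A | (a <= z < b)%O) mobius A a z
    else 0.
Proof.
have lt_count c : (count (fun z => (z < c)%O) A < #|` A|.+1)%N.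
  by rewrite ltnS count_size.
rewrite /mobius (mobius_rec_stable a (m2 := #|` A|.+2)) //=.
by rewrite ltnW // ltnS lt_count.
Qed.

(* Main.v *)
(* The tensor entry at (i_1, ..., i_d) is f(y_m) with y_m = x_{i_1} \/ ... \/ x_{i_d},
   and the product of the entries of E is [y_m <= y_k], by the universal property
   of the join. The theorem is thus dual Moebius inversion on S^{\/d}. The
   recursion defining mu says that the matrix of mu is a left inverse of the zeta
   matrix [y_k <= y_s]; inversion from above needs that it is a right inverse,
   which holds because the matrices are square. *)
Require Import Defs.
From HB Require Import structures.
From mathcomp Require Import all_boot all_order all_algebra.
From mathcomp Require Import finmap.
From mathcomp Require Import boolp classical_sets cardinality reals.
From mathcomp Require Import complex.

Set Implicit Arguments.
Unset Strict Implicit.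
Unset Printing Implicit Defensive.

Import Order.TTheory GRing.Theory Num.Theory.

Local Open Scope ring_scope.

Lemma joins_le {disp : Order.disp_t} {P : joinSemilatticeType disp}
    (p0 : P) (s : seq P) (z : P) :
  s != [::] -> (joins p0 s <= z)%O = all (fun a => (a <= z)%O) s.
Proof.
case: s => //= a s _; elim: s a => [|b s IHs] a /=; first by rewrite andbT.
by rewrite IHs leUx andbA.
Qed.

(** For nonempty lists both joins have the same upper bounds, so antisymmetry identifies them. *)
Lemma joins_perm {disp : Order.disp_t} {P : joinSemilatticeType disp}
    (p0 : P) (s t : seq P) : perm_eq s t -> joins p0 s = joins p0 t.
Proof.
move=> st; have [s0|s0] := eqVneq s [::].
  by move: st; rewrite s0 perm_sym => /perm_nilP ->.
have t0 : t != [::].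
  by apply: contra_neq s0 => t0; apply/perm_nilP; rewrite -t0.
have eq_le z : (joins p0 s <= z)%O = (joins p0 t <= z)%O.
  by rewrite !joins_le //; apply: perm_all.
by apply/le_anti; rewrite eq_le -(eq_le (joins p0 s)) !lexx.
Qed.

(** [join_power] admits only weakly increasing index tuples; sorting an arbitrary tuple gives one
    without changing its join. *)
Lemma joins_in_join_power {disp : Order.disp_t} {P : joinSemilatticeType disp}
    (p0 : P) (n : nat) (x : 'I_n -> P) (d : nat) (i : d.-tuple 'I_n) :
  joins p0 [seq x j | j <- i] \in join_power p0 x d.
Proof.
pose e (j k : 'I_n) := (j <= k)%N.
apply/imfsetP; exists [tuple of sort e i] => /=.
  rewrite inE sorted_map.
  by apply: sort_sorted => j k; apply: leq_total.
by apply/joins_perm/perm_map; rewrite perm_sym perm_sort.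
Qed.

Lemma mobius_notle {disp : Order.disp_t} {P : porderType disp}
    (A : {fset P}) (a b : P) : ~~ (a <= b)%O -> mobius A a b = 0.
Proof.
by rewrite mobiusE le_eqVlt negb_or => /andP[/negPf-> /negPf->].
Qed.

(** If [a < b], the recursion makes the term [z = b] cancel the others; in the remaining cases the
    others contribute nothing. *)
Lemma mobius_zeta {disp : Order.disp_t} {P : porderType disp}
    (A : {fset P}) (a b : P) : b \in A ->
  \sum_(z <- A | (z <= b)%O) mobius A a z = (a == b)%:R.
Proof.
move=> bA; rewrite (big_rem b) //= lexx.
(* Terms with [a <= z] false vanish, which leaves exactly the range of the recursion. *)
have -> : \sum_(z <- rem b A | (z <= b)%O) mobius A a z =
          \sum_(z <- A | (a <= z < b)%O) mobius A a z.
  rewrite [RHS](big_rem b) //= ltxx andbF add0r.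
  rewrite big_seq_cond [RHS]big_seq_cond.
  rewrite (bigID (fun z => (a <= z)%O)) /= [X in _ + X]big1 ?addr0; last first.
    by move=> z /andP[_ /mobius_notle].
  apply: eq_bigl => z; rewrite mem_rem_uniq ?fset_uniq // inE lt_neqAle.
  by case: (z != b) => //=; rewrite ?andbF // -andbA [X in _ && X]andbC.
rewrite mobiusE; have [->|nab] := eqVneq a b.
  rewrite big1 ?addr0 // => z /andP[bz zb].
  by have := le_lt_trans bz zb; rewrite ltxx.
case: ifP => [_|nlt]; first by rewrite addNr.
rewrite add0r big1 // => z /andP[az zb].
by rewrite (le_lt_trans az zb) in nlt.
Qed.

Lemma zeta_mobius {disp : Order.disp_t} {P : porderType disp} (A : {fset P})
    (r : nat) (y : 'I_r -> P) (y_inj : injective y)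
    (y_enum : forall z : P, z \in A <-> exists k, y k = z) (m s : 'I_r) :
  \sum_(k < r | (y m <= y k)%O) mobius A (y k) (y s) = (m == s)%:R.
Proof.
(* [y] lists [A] without repetition, so the sums over [A] in [mobius_zeta] become entries of a
   matrix product. *)
have A_perm : perm_eq A [seq y k | k <- index_enum 'I_r].
  apply: uniq_perm; rewrite ?fset_uniq ?map_inj_uniq ?index_enum_uniq // => z.
  apply/idP/mapP => [/y_enum[k <-]|[k _ ->]]; last by apply/y_enum; exists k.
  by exists k; rewrite ?mem_index_enum.
pose Z : 'M[int]_r := \matrix_(k, l) (y k <= y l)%O%:R.
pose M : 'M[int]_r := \matrix_(k, l) mobius A (y k) (y l).
have MZ : M *m Z = 1%:M.
  apply/matrixP => k l; rewrite !mxE -(inj_eq y_inj) -(mobius_zeta (A := A)).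
    rewrite (perm_big _ A_perm) big_map [RHS]big_mkcond; apply: eq_bigr => j _.
    by rewrite !mxE; case: ifP; rewrite ?mulr1 ?mulr0.
  by apply/y_enum; exists l.
have /matrixP/(_ m s) := mulmx1C MZ; rewrite !mxE => <-.
rewrite big_mkcond; apply: eq_bigr => k _.
by rewrite !mxE; case: ifP; rewrite ?mul1r ?mul0r.
Qed.

Theorem theorem3p1 (R : realType) (disp : Order.disp_t)
    (P : joinSemilatticeType disp) (p0 : P) (P_lf : locally_finite P)
    (n : nat) (x : 'I_n -> P) (x_inj : injective x)
    (x_ord : forall i j : 'I_n, (x i <= x j)%O -> (i <= j)%N)
    (f : P -> R[i]) (d : nat) (d_ge1 : (1 <= d)%N)
    (r : nat) (r_card : r = #|` join_power p0 x d|)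
    (y : 'I_r -> P) (y_inj : injective y)
    (y_enum : forall z : P, z \in join_power p0 x d <-> exists k, y k = z)
    (y_ord : forall k s : 'I_r, (y k <= y s)%O -> (k <= s)%N) :
  let c := fun k : 'I_r =>
    \sum_(s < r | (y k <= y s)%O)
      f (y s) * (mobius (join_power p0 x d) (y k) (y s))%:~R in
  let E : 'M[R[i]]_(n, r) := \matrix_(i, j) (x i <= y j)%O%:R in
  forall i : d.-tuple 'I_n,
    join_tensor p0 x f i = \sum_(k < r) c k * \prod_(t < d) E (tnth i t) k.
Proof.
move=> c E i.
have [m ym] := (y_enum _).1 (joins_in_join_power p0 x i).
have prodE k : \prod_(t < d) E (tnth i t) k = (y m <= y k)%O%:R.
  (* Since [d >= 1] the tuple is nonempty, so this is a genuine join and not the default [p0]. *)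
  rewrite ym joins_le; last by rewrite -size_eq0 size_map size_tuple -lt0n.
  rewrite all_map -big_all big_tuple.
  rewrite (big_morph (fun b : bool => b%:R : R[i]) (op1 := *%R) (id1 := 1)
    (fun a b => _)) //; last by case=> [] []; rewrite /= ?mulr1 ?mulr0.
  by apply: eq_bigr => t _; rewrite mxE.
transitivity (\sum_(k < r | (y m <= y k)%O) c k); last first.
  rewrite big_mkcond; apply: eq_bigr => k _.
  by rewrite prodE; case: ifP; rewrite ?mulr1 ?mulr0.
(* As [mobius] vanishes off the order, the range of [s] can be freed from [k], which allows
   exchanging the two sums. *)
have cE k : c k =
    \sum_(s < r) f (y s) * (mobius (join_power p0 x d) (y k) (y s))%:~R.
  rewrite /c big_mkcond; apply: eq_bigr => s _; case: ifPn => //.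
  by move=> /mobius_notle ->; rewrite mulr0.
under eq_bigr => k _ do rewrite cE.
rewrite exchange_big /=.
under eq_bigr => s _ do
  rewrite -mulr_sumr -rmorph_sum (zeta_mobius y_inj y_enum) /=.
(* The inner sum over [k] is now the Kronecker delta of [m] and [s], so only [f (y m)] survives. *)
rewrite (bigD1 m) //= eqxx mulr1 big1 ?addr0 => [|s /negPf].
  by rewrite /join_tensor ym.
by rewrite eq_sym => ->; rewrite mulr0.
Qed.
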